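(* Let $G=L\ltimes U$ be a (block upper triangular) parabolic subgroup of $\mathrm{GL}(n,\mathbb{F}_q)$ with exactly two diagonal blocks. Then the $UU$-supercharacter theory of $G$ coincides with the theory of irreducible characters of $G$; that is, $\{\chi''_\alpha:\alpha\in\mathcal{A}''\}$ is the set of all irreducible complex characters of $G$ and $\{K''_\beta:\beta\in\mathcal{B}''\}$ is the set of all conjugacy classes of $G$.
   Context: **Parabolic subgroup.** Decompose $[1,n]=I_1\cup\dots\cup I_\ell$ into consecutive segments, $n_k=|I_k|$ (here $\ell=2$). $G$ is the group of invertible block upper triangular matrices over the finite field $\mathbb{F}_q$ for this decomposition, $L=\mathrm{GL}(n_1,\mathbb{F}_q)\times\dots\times\mathrm{GL}(n_\ell,\mathbb{F}_q)$ is the block diagonal subgroup, $J$ is the algebra of strictly block upper triangular matrices, and $U=1+J$, so $G=L\ltimes U$. The group $G$ acts on $J$ by left and right matrix multiplication, and on $J^*$ by $(g\lambda)(x)=\lambda(xg)$, $(\lambda g)(x)=\lambda(gx)$; for $h\in L$, $\mathrm{Ad}_h(x)=hxh^{-1}$ and $\mathrm{Ad}^*_h(\lambda)=h\lambda h^{-1}$. **$UU$-supercharacter theory: characters.** Fix a nontrivial character $t\mapsto\varepsilon^t$ of the additive group of $\mathbb{F}_q$ with values in $\mathbb{C}^*$. For $\lambda\in J^*$ let $J_{\lambda,\mathrm{right}}=\{y\in J:\ \lambda(yx)=0 \text{ for all } x\in J\}$ and $U_{\lambda,\mathrm{right}}=1+J_{\lambda,\mathrm{right}}$. Let $H_{U\lambda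 U}=\{h\in L:\ \mathrm{Ad}^*_h(\mu)=\mu \text{ for all }\mu\in U\lambda U\}$ and $S_{U\lambda U}=\{r\in L:\ \mathrm{Ad}_r^*(U\lambda U)=U\lambda U\}$; $H_{U\lambda U}$ is normal in $S_{U\lambda U}$. For a normal subgroup $N$ of a group $S$, an $S$-irreducible character of $N$ is the sum of the distinct irreducible complex characters of $N$ in one $S$-conjugation orbit. Let $\mathcal{A}''_0$ be the set of pairs $(\theta,\lambda)$, where $\lambda$ runs through representatives of the $U\times U$ orbits in $J^*$ (so $\lambda$ stands for the orbit $U\lambda U$) and $\theta$ runs through the $S_{U\lambda U}$-irreducible characters of $H_{U\lambda U}$. The group $L$ acts on $\mathcal{A}''_0$ by conjugation: $r\in L$ sends the orbit $U\lambda U$ to $r(U\lambda U)r^{-1}$ and $\theta$ to the character $h\mapsto\theta(r^{-1}hr)$ of $rH_{U\lambda U}r^{-1}$. $\mathcal{A}''$ is the set of $L$-orbits in $\mathcal{A}''_0$. For $\alpha\in\mathcal{A}''$ represented by $(\theta,\lambda)$, $\chi''_\alpha$ is the character of $G$ induced from the character $\xi_{\theta,\lambda}(h(1+x))=\theta(h)\varepsilon^{\lambda(x)}$ ($h\in H_{U\lambda U}$, $x\in J_{\lambda,\mathrm{right}}$) of the subgroup $H_{U\lambda U}\ltimes U_{\lambda,\mathrm{right}}$. **$UU$-supercharacter theory: classes.** For $h\in L$, let $J''_h$ be the least two-sided ideal of $J$ such that $\mathrm{Ad}_h$ acts as the identity on $J/J''_h$, and let $\pi''_h:J\to J/J''_h$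 be the natural projection. Let $\mathcal{B}''_0$ be the set of pairs $(h,\omega)$, where $h\in L$ and $\omega$ is a $U\times U$ orbit in $J/J''_h$ (left and right multiplication). $L$ acts on $\mathcal{B}''_0$ by $r\cdot(h,\omega)=(rhr^{-1},r\omega r^{-1})$, and $\mathcal{B}''$ is the set of $L$-orbits. For $\beta\in\mathcal{B}''$ represented by $(h,\omega)$ put $K''_\beta=\bigcup_{p\in L}p\,\bigl(h(1+(\pi''_h)^{-1}(\omega))\bigr)\,p^{-1}$. *)

(* Defs.v *)
From HB Require Import structures.
From mathcomp Require Import all_boot all_order all_algebra all_fingroup.
From mathcomp Require Import all_solvable all_field all_character.

Set Implicit Arguments.
Unset Strict Implicit.
Unset Printing Implicit Defensive.

Import GroupScope GRing.Theory.
Local Open Scope ring_scope.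

(* The field of complex numbers is represented by algC, as in mathcomp's      *)
(* character theory.                                                          *)
Definition nontrivial_add_char (F : finFieldType) (eps : F -> algC) : Prop :=
  [/\ forall a b, eps (a + b) = eps a * eps b,
      forall a, eps a != 0 & exists a, eps a != 1].

(* blk i is the position, among the consecutive segments, of the segment that *)
(* contains the index i; here the segments have lengths n1 and n2.            *)
Definition two_segments (n1 n2 : nat) (i : 'I_(n1 + n2).-1.+1) : nat :=
  (n1 <= i)%N.
Arguments two_segments : clear implicits.

Section Parabolic.

Variables (F : finFieldType) (N : nat) (blk : 'I_N.+1 -> nat).

Local Notation gT := {'GL_N.+1[F]}.
Local Notation mT := 'M[F]_N.+1.
Local Notation mx g := (@GLval N.+1 F g : mT).

Definition parabolic : {set gT} :=
  [set g : gT | [forall i, forall j, (blk j < blk i)%N ==> (mx g i j == 0)]].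

Definition levi : {set gT} :=
  [set g : gT | [forall i, forall j, (blk i != blk j) ==> (mx g i j == 0)]].

Definition nilJ : {set mT} :=
  [set x : mT | [forall i, forall j, (blk j <= blk i)%N ==> (x i j == 0)]].

Definition oneplus (A : {set mT}) : {set gT} := [set u : gT | mx u - 1 \in A].

Definition unipU : {set gT} := oneplus nilJ.

Lemma parabolicP (g : gT) : reflect (forall i j, (blk j < blk i)%N -> mx g i j = 0)
                             (g \in parabolic).
Proof.
rewrite inE; apply: (iffP 'forall_forallP) => H i j; first by move/(implyP (H i j))/eqP.
by apply/implyP => /H ->.
Qed.

Lemma leviP (g : gT) : reflect (forall i j, blk i != blk j -> mx g i j = 0)
                        (g \in levi).
Proof.
rewrite inE; apply: (iffP 'forall_forallP) => H i j; first by move/(implyP (H i j))/eqP.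
by apply/implyP => /H ->.
Qed.

Lemma nilJP (x : mT) : reflect (forall i j, (blk j <= blk i)%N -> x i j = 0)
                        (x \in nilJ).
Proof.
rewrite inE; apply: (iffP 'forall_forallP) => H i j; first by move/(implyP (H i j))/eqP.
by apply/implyP => /H ->.
Qed.

Fact parabolic_group_set : group_set parabolic.
Proof.
apply/group_setP; split=> [|g h /parabolicP Gg /parabolicP Gh].
  apply/parabolicP=> i j ltji; rewrite GL_1E mxE.
  by have [eij | _] := eqVneq i j; rewrite // eij ltnn in ltji.
apply/parabolicP=> i j ltji; rewrite GL_ME mxE big1 // => k _.
have [ltki | leik] := ltnP (blk k) (blk i); first by rewrite Gg ?mul0r.
by rewrite Gh ?mulr0 // (leq_trans ltji).
Qed.
Canonical parabolic_group := Group parabolic_group_set.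

Fact levi_group_set : group_set levi.
Proof.
apply/group_setP; split=> [|g h /leviP Lg /leviP Lh].
  apply/leviP=> i j nij; rewrite GL_1E mxE.
  by have [eij | _] := eqVneq i j; rewrite // eij eqxx in nij.
apply/leviP=> i j nij; rewrite GL_ME mxE big1 // => k _.
have [eik | nik] := eqVneq (blk i) (blk k); last by rewrite Lg ?mul0r.
by rewrite Lh ?mulr0 // -eik.
Qed.
Canonical levi_group := Group levi_group_set.

(* A linear form on J is encoded by its extension by zero to all matrices.    *)
(* For g in G, x *m g and g *m x lie in J exactly when x does, so that the    *)
(* action of G on J^* is well defined on this encoding.                       *)
Definition dualJ : {set {ffun mT -> F}} :=
  [set lam : {ffun mT -> F} |
     [forall x, (x \notin nilJ) ==> (lam x == 0)]
     && [forall a, forall x in nilJ, forall y in nilJ,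
           lam (a *: x + y) == a * lam x + lam y]].

(* dact g lam h is g lam h, since (g lam)(x) = lam (x g) and                  *)
(* (lam h)(x) = lam (h x).                                                    *)
Definition dact (g : gT) (lam : {ffun mT -> F}) (h : gT) : {ffun mT -> F} :=
  [ffun x => lam (mx h *m x *m mx g)].

Definition Adstar (h : gT) (lam : {ffun mT -> F}) : {ffun mT -> F} :=
  dact h lam h^-1.

Definition AdstarS (h : gT) (O : {set {ffun mT -> F}}) :
  {set {ffun mT -> F}} := [set Adstar h mu | mu in O].

Definition UUorbit (lam : {ffun mT -> F}) : {set {ffun mT -> F}} :=
  [set dact u lam v | u in unipU, v in unipU].

Definition Jright (lam : {ffun mT -> F}) : {set mT} :=
  [set y in nilJ | [forall x in nilJ, lam (y *m x) == 0]].

Definition Uright (lam : {ffun mT -> F}) : {set gT} := oneplus (Jright lam).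

Definition HUU (O : {set {ffun mT -> F}}) : {set gT} :=
  [set h in levi | [forall mu in O, Adstar h mu == mu]].

Definition SUU (O : {set {ffun mT -> F}}) : {set gT} :=
  [set r in levi | AdstarS r O == O].

Lemma Adstar1 lam : Adstar 1%g lam = lam.
Proof. by apply/ffunP=> x; rewrite ffunE invg1 GL_1E mul1mx mulmx1. Qed.

Lemma AdstarM g h lam : Adstar (g * h)%g lam = Adstar g (Adstar h lam).
Proof.
by apply/ffunP=> x; rewrite !ffunE invMg !GL_ME -!mulmxE !mulmxA.
Qed.

Fact HUU_group_set O : group_set (HUU O).
Proof.
apply/group_setP; split=> [|g h].
  by rewrite inE group1; apply/forall_inP=> mu _; rewrite Adstar1.
move=> /setIdP[Lg /forall_inP Hg] /setIdP[Lh /forall_inP Hh].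
rewrite inE groupM //; apply/forall_inP=> mu Omu.
by rewrite AdstarM (eqP (Hh mu Omu)) Hg.
Qed.
Canonical HUU_group O := Group (HUU_group_set O).

Lemma AdstarSM g h O : AdstarS (g * h)%g O = AdstarS g (AdstarS h O).
Proof.
rewrite /AdstarS -imset_comp; apply: eq_imset => mu /=; exact: AdstarM.
Qed.

Fact SUU_group_set O : group_set (SUU O).
Proof.
apply/group_setP; split=> [|g h].
  rewrite inE group1; apply/eqP; rewrite -[RHS]imset_id.
  by apply: eq_imset => mu; rewrite Adstar1.
move=> /setIdP[Lg /eqP Sg] /setIdP[Lh /eqP Sh].
by rewrite inE groupM // AdstarSM Sh Sg eqxx.
Qed.
Canonical SUU_group O := Group (SUU_group_set O).

Lemma HUU_normal O : HUU O <| SUU O.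
Proof.
apply/andP; split.
  apply/subsetP=> h /setIdP[Lh /forall_inP Hh]; rewrite inE Lh /=; apply/eqP.
  by rewrite -[RHS]imset_id; apply: eq_in_imset => mu /Hh/eqP.
apply/subsetP=> r Sr; rewrite inE; apply/subsetP=> _ /imsetP[h Hh ->].
have [Lh /forall_inP Ah] := setIdP Hh; have [Lr /eqP Or] := setIdP Sr.
rewrite inE groupJ //=; apply/forall_inP=> mu Omu; apply/eqP.
rewrite conjgE !AdstarM (eqP (Ah _ _)) -?AdstarM ?mulVg ?Adstar1 //.
by rewrite -Or; apply/imsetP; exists mu.
Qed.

(* ('chi_i ^: S)%CF is the duplicate-free list of S-conjugates of 'chi_i.     *)
Definition is_irr_under (gT0 : finGroupType) (S H : {group gT0})
    (theta : 'CF(H)) : Prop :=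
  exists i : Iirr H, theta = \sum_(psi <- ('chi_i ^: S)%CF) psi.

Definition UUpair := {O : {set {ffun mT -> F}} & 'CF(HUU O)}.

Definition A0 (p : UUpair) : Prop :=
  (exists2 lam, lam \in dualJ & tag p = UUorbit lam)
  /\ is_irr_under (SUU_group (tag p)) (tagged p).

(* q is r . p for some r in L; note that h ^ r = r^-1 h r.                    *)
Definition Lconj_pair (p q : UUpair) : Prop :=
  exists r, [/\ r \in levi, tag q = AdstarS r (tag p)
    & forall h, h \in HUU (tag q) -> tagged q h = tagged p (h ^ r)%g].

Definition AA (alpha : UUpair -> Prop) : Prop :=
  exists2 p, A0 p & forall q, alpha q <-> Lconj_pair p q.

(* For h in H_{U lam U} and u = 1 + x in U_{lam,right}, x = mx u - 1.      *)
Definition is_xi (eps : F -> algC) (lam : {ffun mT -> F})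
    (theta : 'CF(HUU (UUorbit lam)))
    (xi : 'CF(HUU (UUorbit lam) <*> Uright lam)) : Prop :=
  forall h u, h \in HUU (UUorbit lam) -> u \in Uright lam ->
    xi (h * u)%g = theta h * eps (lam (mx u - 1)).

Lemma nilJ_lin a x y : x \in nilJ -> y \in nilJ -> a *: x + y \in nilJ.
Proof.
move=> /nilJP Jx /nilJP Jy; apply/nilJP=> i j leji.
by rewrite !mxE Jx // Jy // mulr0 addr0.
Qed.

Lemma nilJ0 : 0 \in nilJ.
Proof. by apply/nilJP=> i j _; rewrite mxE. Qed.

Lemma nilJD x y : x \in nilJ -> y \in nilJ -> x + y \in nilJ.
Proof. by move=> Jx Jy; rewrite -[x]scale1r nilJ_lin. Qed.

Lemma levi_parabolic : levi \subset parabolic.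
Proof.
apply/subsetP=> h /leviP Lh; apply/parabolicP=> i j ltji; apply: Lh.
by rewrite neq_ltn ltji orbT.
Qed.

Lemma nilJ_mull g x : g \in parabolic -> x \in nilJ -> mx g *m x \in nilJ.
Proof.
move=> /parabolicP Gg /nilJP Jx; apply/nilJP=> i j leji; rewrite mxE big1 // => k _.
have [ltki | leik] := ltnP (blk k) (blk i); first by rewrite Gg ?mul0r.
by rewrite Jx ?mulr0 // (leq_trans leji).
Qed.

Lemma nilJ_mulr g x : g \in parabolic -> x \in nilJ -> x *m mx g \in nilJ.
Proof.
move=> /parabolicP Gg /nilJP Jx; apply/nilJP=> i j leji; rewrite mxE big1 // => k _.
have [ltjk | lekj] := ltnP (blk j) (blk k); first by rewrite Gg ?mulr0.
by rewrite Jx ?mul0r // (leq_trans lekj).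
Qed.

Lemma nilJM x y : x \in nilJ -> y \in nilJ -> x *m y \in nilJ.
Proof.
move=> /nilJP Jx /nilJP Jy; apply/nilJP=> i j leji; rewrite mxE big1 // => k _.
have [leki | ltik] := leqP (blk k) (blk i); first by rewrite Jx ?mul0r.
by rewrite Jy ?mulr0 // (leq_trans leji) // ltnW.
Qed.

Lemma mem_oneplus (A : {set mT}) (u : gT) : (u \in oneplus A) = (mx u - 1 \in A).
Proof. by rewrite inE. Qed.

Lemma mem_UUorbit lam : lam \in UUorbit lam.
Proof.
apply/imset2P; exists 1%g 1%g; rewrite ?mem_oneplus ?GL_1E ?subrr ?nilJ0 //.
by apply/ffunP=> x; rewrite ffunE GL_1E mul1mx mulmx1.
Qed.

Section Xi.

Variables (eps : F -> algC) (lam : {ffun mT -> F}).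
Hypotheses (epsP : nontrivial_add_char eps) (lamJ : lam \in dualJ).

Let H := HUU (UUorbit lam).
Let V := Uright lam.

Let lam_lin a x y : x \in nilJ -> y \in nilJ ->
  lam (a *: x + y) = a * lam x + lam y.
Proof.
move=> Jx Jy; move: lamJ; rewrite inE => /andP[_ /forallP/(_ a)].
by move/forall_inP/(_ x Jx)/forall_inP/(_ y Jy)/eqP.
Qed.

Let lamD x y : x \in nilJ -> y \in nilJ -> lam (x + y) = lam x + lam y.
Proof. by move=> Jx Jy; rewrite -[x]scale1r lam_lin // scale1r mul1r. Qed.

Let VP u : reflect (mx u - 1 \in nilJ /\
    forall x, x \in nilJ -> lam ((mx u - 1) *m x) = 0) (u \in V).
Proof.
rewrite mem_oneplus; apply: (iffP setIdP) => -[Ju Vu]; split=> //.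
  by move=> x Jx; apply/eqP/(forall_inP Vu).
by apply/forall_inP=> x Jx; rewrite Vu.
Qed.

Let GLM1 u v : mx (u * v)%g - 1 = (mx u - 1) + (mx v - 1) + (mx u - 1) *m (mx v - 1).
Proof.
have E (a b : mT) : (a + 1) * (b + 1) - 1 = a + b + a * b.
  by rewrite mulrDl mul1r mulrDr mulr1 addrA addrK -addrA addrC.
by rewrite mulmxE -E !subrK GL_ME.
Qed.

Fact Uright_group_set : group_set V.
Proof.
apply/group_setP; split=> [|u v /VP[Ju Vu] /VP[Jv Vv]].
  apply/VP; rewrite GL_1E subrr; split=> [|x _]; first exact: nilJ0.
  by rewrite mul0mx; have := lam_lin (-1) nilJ0 nilJ0;
    rewrite scaler0 addr0 mulN1r addNr.
have Juv := nilJD Ju Jv; have JuMv := nilJM Ju Jv.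
apply/VP; rewrite GLM1; split=> [|x Jx]; first exact: nilJD.
move: (mx u - 1) (mx v - 1) Ju Vu Jv Vv Juv JuMv => a b Ja Va Jb Vb Jab JaMb.
rewrite !mulmxDl !lamD ?(nilJD (nilJM Ja Jx)) ?nilJM // -mulmxA.
by rewrite Va // Vb // Va ?nilJM // !addr0.
Qed.

Let VG := Group Uright_group_set.

Let mxVK h : mx h^-1%g *m mx h = 1.
Proof. by rewrite -[LHS]/(mx (h^-1 * h)%g) mulVg. Qed.

Let mxKV h : mx h *m mx h^-1%g = 1.
Proof. by rewrite -[LHS]/(mx (h * h^-1)%g) mulgV. Qed.

Let H_lam h x : h \in H -> lam (mx h^-1%g *m x *m mx h) = lam x.
Proof.
case/setIdP=> _ /forall_inP/(_ _ (mem_UUorbit lam))/eqP.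
by move/ffunP/(_ x); rewrite ffunE.
Qed.

Let GLJ1 u h : mx (u ^ h)%g - 1 = mx h^-1%g *m (mx u - 1) *m mx h.
Proof.
by rewrite conjgE !GL_ME mulmxBr mulmxBl mulmx1 mxVK -!mulmxE mulmxA.
Qed.

Let H_parabolic h : h \in H -> h \in parabolic.
Proof. by case/setIdP=> /(subsetP levi_parabolic). Qed.

Lemma HUU_norm_Uright : H \subset 'N(V).
Proof.
apply/subsetP=> h Hh; have Gh := H_parabolic Hh.
rewrite inE; apply/subsetP=> _ /imsetP[u /VP[Ju Vu] ->].
apply/VP; rewrite GLJ1; split.
  by rewrite nilJ_mulr ?nilJ_mull ?groupV.
move=> x Jx; rewrite -(H_lam _ (groupVr Hh)) invgK !mulmxA mxKV mul1mx.
by rewrite -!mulmxA Vu // nilJ_mull ?nilJ_mulr ?groupV.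
Qed.

Lemma UUsubgroupE : H <*> V = (H * V)%g.
Proof. exact: (@norm_joinEl _ (HUU_group _) VG HUU_norm_Uright). Qed.

Lemma HUU_Uright_TI : V :&: H = 1%g.
Proof.
apply/eqP; rewrite eqEsubset; apply/andP; split; last first.
  by apply/subsetP=> _ /set1P->; rewrite inE (group1 VG) group1.
apply/subsetP=> u /setIP[/VP[/nilJP Ju _] /setIdP[/leviP Lu _]].
apply/set1P; apply: val_inj; rewrite -[RHS]/(1 : mT) /=.
apply/matrixP=> i j; have [eij | nij] := eqVneq (blk i) (blk j).
  have: (mx u - 1) i j = 0 by apply: Ju; rewrite eij.
  by rewrite 2!mxE => /eqP; rewrite subr_eq0 => /eqP.
rewrite Lu // mxE; have [eij | //] := eqVneq i j.
by rewrite eij eqxx in nij.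
Qed.

Lemma Uright_sdprod : V ><| H = H <*> V.
Proof.
rewrite (@sdprodE _ VG (HUU_group _)) ?HUU_norm_Uright ?HUU_Uright_TI //.
by rewrite UUsubgroupE -(@normC _ (HUU_group _) VG) ?HUU_norm_Uright.
Qed.

Let eV u := eps (lam (mx u - 1)).

Let eVM u v : u \in V -> v \in V -> eV (u * v)%g = eV u * eV v.
Proof.
move=> /VP[Ju Vu] /VP[Jv Vv]; have [epsD _ _] := epsP.
rewrite /eV -epsD GLM1; move: (mx u - 1) (mx v - 1) Ju Vu Jv => a b Ja Va Jb.
by rewrite (lamD (nilJD Ja Jb)) ?nilJM // Va // addr0 lamD.
Qed.

Let eVJ u h : h \in H -> eV (u ^ h)%g = eV u.
Proof. by move=> Hh; rewrite /eV GLJ1 H_lam. Qed.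

Let eV_neq0 u : eV u != 0.
Proof. by case: epsP => _ + _; exact. Qed.

Let HV := (HUU_group (UUorbit lam) <*> VG)%G.

Lemma xi_exists (theta : 'CF(H)) :
  exists xi : 'CF(H <*> V), is_xi eps theta xi.
Proof.
pose f g := theta (remgr V H g) * eV (divgr V H g) *+ (g \in HV).
have nHV := subsetP HUU_norm_Uright.
have fE u h : u \in V -> h \in H -> f (u * h)%g = theta h * eV u.
  move=> Vu Hh; rewrite /f (@remgrMid _ VG (HUU_group _)) ?HUU_Uright_TI //.
  rewrite (@divgrMid _ VG (HUU_group _)) ?HUU_Uright_TI //.
  by rewrite groupM ?mulr1n // mem_gen // inE ?Vu ?Hh ?orbT.
have HVP g : g \in HV -> exists h u, [/\ h \in H, u \in V & g = (u * h)%g].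
  have ->: HV = (V * H)%g :> {set _} by have [] := sdprodP Uright_sdprod.
  by case/mulsgP=> u h Vu Hh ->; exists h, u.
have fJH g k : g \in HV -> k \in H -> f (g ^ k)%g = f g.
  case/HVP=> h [u [Hh Vu ->]] Hk; have Hhk: (h ^ k)%g \in H by rewrite groupJ.
  have Vuk: (u ^ k)%g \in V by rewrite memJ_norm ?nHV.
  by rewrite conjMg !fE // eVJ // cfunJgen ?genGid.
have fJV g v : g \in HV -> v \in V -> f (g ^ v)%g = f g.
  case/HVP=> h [u [Hh Vu ->]] Vv.
  have Vvh : (v ^ h^-1)%g \in V by rewrite memJ_norm ?nHV ?groupV.
  have ->: ((u * h) ^ v = v^-1 * u * (v ^ h^-1) * h)%g.
    by rewrite /conjg invgK !mulgA mulgKV.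
  have Vv' := @groupVr _ VG _ Vv.
  have Vvu := @groupM _ VG _ _ Vv' Vu.
  have Vw := @groupM _ VG _ _ Vvu Vvh.
  rewrite (fE _ _ Vw Hh) (fE _ _ Vu Hh) (eVM Vvu Vvh) (eVM Vv' Vu) eVJ ?groupV //.
  rewrite (mulrAC (eV v^-1)) -(eVM Vv' Vv) mulVg; congr (_ * _).
  have -> : eV 1%g = 1; last by rewrite mul1r.
  have V1 := group1 VG; apply: (mulfI (eV_neq0 1%g)).
  by rewrite mulr1 -eVM ?mulg1.
have fcf : is_class_fun <<HV>> (finfun f).
  rewrite genGid; apply: intro_class_fun => [g y HVg /HVP[k [v [Hk Vv ->]]] | g notHVg].
    rewrite conjgM fJH ?fJV // groupJ //.
    by rewrite mem_gen // inE Vv orbT.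
  by rewrite /f (negPf notHVg).
exists (Cfun 0 fcf) => h u Hh Vu; rewrite cfunE.
have Vuh : (u ^ h^-1)%g \in V by rewrite memJ_norm ?nHV ?groupV.
have ->: (h * u = (u ^ h^-1) * h)%g by rewrite /conjg invgK mulgA mulgKV.
by rewrite fE // eVJ ?groupV.
Qed.

Lemma xi_unique (theta : 'CF(H)) (xi xi' : 'CF(H <*> V)) :
  is_xi eps theta xi -> is_xi eps theta xi' -> xi = xi'.
Proof.
move=> xiP xiP'; apply/cfun_inP=> g HVg.
have: g \in H <*> V by []; rewrite UUsubgroupE.
by case/mulsgP=> h u Hh Vu ->; rewrite xiP ?xiP'.
Qed.

End Xi.

(* chi is the character attached to alpha through some representative of      *)
(* alpha; xi is determined by (theta, lam), see xi_exists and xi_unique.      *)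
Definition is_chiUU (eps : F -> algC) (alpha : UUpair -> Prop)
    (chi : 'CF(parabolic)) : Prop :=
  exists lam theta,
    [/\ lam \in dualJ,
        alpha (Tagged (fun O => 'CF(HUU O)) (theta : 'CF(HUU (UUorbit lam))))
      & exists2 xi, is_xi eps theta xi & chi = 'Ind[parabolic] xi].

Definition is_ideal (I : {set mT}) : bool :=
  [&& I \subset nilJ, 0 \in I,
      [forall a : F, forall x in I, forall y in I, a *: x + y \in I]
    & [forall x in I, forall y in nilJ, (x *m y \in I) && (y *m x \in I)]].

Definition Ad (h : gT) (x : mT) : mT := mx h *m x *m mx (h^-1%g).

Definition Ad_trivial_mod (h : gT) (I : {set mT}) : bool :=
  [forall x in nilJ, Ad h x - x \in I].

Definition Jh (h : gT) : {set mT} :=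
  \bigcap_(I : {set mT} | is_ideal I && Ad_trivial_mod h I) I.

Lemma is_idealP (I : {set mT}) :
  reflect [/\ I \subset nilJ, 0 \in I,
    forall a x y, x \in I -> y \in I -> a *: x + y \in I
    & forall x y, x \in I -> y \in nilJ -> x *m y \in I /\ y *m x \in I]
  (is_ideal I).
Proof.
apply: (iffP and4P) => -[sIJ I0 Il Im]; split=> //.
- by move=> a x y Ix; move/forallP/(_ a)/forall_inP/(_ x Ix)/forall_inP: Il; apply.
- by move=> x y Ix Jy; apply/andP; move: y Jy; apply/forall_inP/(forall_inP Im).
- apply/forallP=> a; apply/forall_inP=> x Ix; apply/forall_inP=> y; exact: Il.
by apply/forall_inP=> x Ix; apply/forall_inP=> y Jy; apply/andP/Im.
Qed.

Lemma Jh_least h : h \in levi ->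
  [/\ is_ideal (Jh h), Ad_trivial_mod h (Jh h)
    & forall I, is_ideal I -> Ad_trivial_mod h I -> Jh h \subset I].
Proof.
move=> Lh; have Gh := subsetP levi_parabolic h Lh.
have idJ: is_ideal nilJ.
  by apply/is_idealP; split=> [||a x y|x y] //; [exact: nilJ0 | exact: nilJ_lin |
    split; exact: nilJM].
have adJ: Ad_trivial_mod h nilJ.
  apply/forall_inP=> x Jx; rewrite addrC -scaleN1r nilJ_lin //.
  by rewrite nilJ_mulr ?nilJ_mull ?groupV.
split=> [||I idI adI]; last by apply: bigcap_inf; rewrite idI.
  apply/is_idealP; split=> [||a x y /bigcapP Ix /bigcapP Iy|x y /bigcapP Ix Jy].
  - by apply: bigcap_inf; rewrite idJ.
  - by apply/bigcapP=> I /andP[/is_idealP[]].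
  - apply/bigcapP=> I cI; have /andP[/is_idealP[_ _ Il _] _] := cI.
    by apply: Il; [exact: Ix | exact: Iy].
  by split; apply/bigcapP=> I cI; have /andP[/is_idealP[_ _ _ Im] _] := cI;
     case: (Im x y (Ix I cI) Jy).
apply/forall_inP=> x Jx; apply/bigcapP=> I /andP[_ /forall_inP]; exact.
Qed.

Definition addcoset (I : {set mT}) (x : mT) : {set mT} := [set x + y | y in I].

(* An orbit in J / J_h is a set of cosets of J_h; u (x + J_h) v is the set of *)
(* products u y v for y in x + J_h, since u J_h v = J_h.                      *)
Definition bimulS (u : gT) (c : {set mT}) (v : gT) : {set mT} :=
  [set mx u *m y *m mx v | y in c].

Definition UUorbit_mod (h : gT) (x : mT) : {set {set mT}} :=
  [set bimulS u (addcoset (Jh h) x) v | u in unipU, v in unipU].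

Definition B0 : {set gT * {set {set mT}}} :=
  [set (h, UUorbit_mod h x) | h in levi, x in nilJ].

Definition Lact_pair (r : gT) (b : gT * {set {set mT}}) :
    gT * {set {set mT}} :=
  (r * b.1 * r^-1, [set bimulS r c r^-1 | c in b.2])%g.

Definition BB : {set {set gT * {set {set mT}}}} :=
  [set [set Lact_pair r b | r in levi] | b in B0].

Definition preim_mod (h : gT) (om : {set {set mT}}) : {set mT} :=
  [set x in nilJ | addcoset (Jh h) x \in om].

(* A :^ p^-1 is p A p^-1.                                                     *)
Definition KUU (b : gT * {set {set mT}}) : {set gT} :=
  (\bigcup_(p in levi) (b.1 *: oneplus (preim_mod b.1 b.2)) :^ p^-1)%g.

End Parabolic.

(* Main.v *)
Require Import Defs.
From mathcomp Require Import all_boot all_order all_algebra all_fingroup.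
From mathcomp Require Import all_solvable all_field all_character.

(** With two blocks a product of two elements of J vanishes, because an entry
    of a strictly block upper triangular matrix leads from the first segment to
    the second and two such steps cannot be composed.  Everything follows from
    J * J = 0, that is from U = 1 + J being abelian, with x |-> 1 + x turning
    addition of J into the product of U.

    Characters.  Since u x v = x for u, v in U and x in J, every U x U orbit in
    the dual of J is a single form lam, U_{lam,right} is all of U, and the
    groups S and H attached to the orbit both equal the stabilizer of lam in L.
    So an S-irreducible character of H is an irreducible character of H, and
    the characters attached to the pairs (theta, lam) are exactly those that
    the little group method of Wigner and Mackey produces for the semidirect
    product of L with the abelian normal subgroup U: first every linear
    character psi of U is 1 + x |-> eps (lam x) for a form lam
    ([irr_unipU_form]); the inertia group of psi is the product of the
    stabilizer H of lam with U, and psi extends to it by 1 on H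
    ([linear_extension]); finally theta |-> Ind (theta * psi) runs, as psi and
    theta vary, through the irreducible characters of G ([little_group_irr],
    [little_group_exhaust]).  The latter rests on Clifford theory and on the
    fact that dividing by the extension of psi yields a character that is
    trivial on U.

    Classes.  An ideal of J is just a subspace, so that the ideal attached to h
    in L is the image of Ad_h - 1 ([JhE]), and the U x U orbits in the quotient
    are points.  Conjugation of h (1 + x) by 1 + Ad_h y gives
    h (1 + x + Ad_h y - y) ([conj_U1]): the U-conjugates of h (1 + x) fill
    exactly the coset of h that belongs to the class of x modulo this ideal.
    Conjugating further by L gives the G-class of h (1 + x), as G = U L
    ([KUU_class]). *)

Set Implicit Arguments.
Unset Strict Implicit.
Unset Printing Implicit Defensive.

Import GroupScope GRing.Theory Num.Theory.
Local Open Scope ring_scope.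

(** * The little group method *)

(** A multiplicative function is the trace of its one-dimensional
    representation. *)
Lemma lin_char_of_morph (gT : finGroupType) (G : {group gT}) (xi : 'CF(G)) :
  xi 1%g = 1 -> {in G &, {morph xi : x y / (x * y)%g >-> x * y}} ->
  xi \is a linear_char.
Proof.
move=> xi1 xiM; pose r x : 'M[algC]_1 := (xi x)%:M.
have rP : mx_repr G r.
  split=> [|x y Gx Gy]; first by rewrite /r xi1.
  by rewrite /r xiM // scalar_mxM.
rewrite qualifE /= xi1 eqxx andbT.
suff ->: xi = cfRepr (MxRepresentation rP) by apply: cfRepr_char.
by apply/cfun_inP=> x Gx; rewrite cfunE Gx mulr1n mxtrace_scalar mulr1n.
Qed.

(** The Clifford correspondence for an arbitrary group T equal to the inertia
    group, which avoids a dependence of the types of characters of T on the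
    form 'I_G['chi_t]; the last clause holds because 'chi_t is its own only
    conjugate under its inertia group. *)
Lemma inertia_correspondence (gT : finGroupType) (G U T : {group gT})
    (t : Iirr U) : U <| G -> 'I_G['chi_t]%g = T ->
  [/\ forall s, s \in irr_constt ('Ind[T] 'chi_t) ->
        'Ind[G, T] 'chi_s \in irr G,
      forall i, i \in irr_constt ('Ind[G] 'chi_t) ->
        exists2 s, s \in irr_constt ('Ind[T] 'chi_t)
                 & 'chi_i = 'Ind[G, T] 'chi_s
    & forall s, s \in irr_constt ('Ind[T] 'chi_t) ->
        exists c, 'Res[U] 'chi_s = c *: 'chi_t].
Proof.
move=> nsUG defI; have {defI} <- : 'I_G['chi_t]%G = T by apply: group_inj.
have [irrInd _ imInd _] := constt_Inertia_bijection t nsUG.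
split=> [s /irrInd // | i | s].
  by rewrite -imInd => /imsetP[s As ->]; exists s => //;
    rewrite cfIirrE ?irrInd.
rewrite constt_Ind_Res => Ast; exists '['Res[U] 'chi_s, 'chi_t].
rewrite {1}(Clifford_Res_sum_cfclass _ Ast) ?normal_Inertia ?normal_sub //.
by rewrite cfclass_inertia big_seq1.
Qed.

(** The setting of the little group method: the linear character 'Res[U] ext of
    the normal subgroup U has a complemented inertia group T and extends to
    T. *)
Section LittleGroups.

Variables (gT : finGroupType) (G U H T : {group gT}) (ext : 'CF(T)).
Hypotheses (nsUG : U <| G) (defT : (U ><| H)%g = T).
Hypothesis ext_lin : ext \is a linear_char.
Hypothesis inertT : 'I_G['Res[U] ext]%g = T.

Let sUT : U \subset T.
Proof. by have [/andP[]] := sdprod_context defT. Qed.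

Let lin_psi : 'Res[U] ext \is a linear_char.
Proof. exact: cfRes_lin_char. Qed.

(** The inflation of theta to T times a linear character is irreducible, and it
    restricts to a multiple of 'Res[U] ext, so that the Clifford correspondence
    applies to it. *)
Lemma little_group_irr theta :
  theta \in irr H -> 'Ind[G] (cfSdprod defT theta * ext) \in irr G.
Proof.
move=> irr_theta; have /irrP[t Dt] := lin_char_irr lin_psi.
have irr_phi : cfSdprod defT theta * ext \in irr T.
  by rewrite mulrC mul_lin_irr // cfSdprod_irr.
have [|irrInd _ _] := inertia_correspondence (T := T) (t := t) nsUG.
  by rewrite -Dt.
case/irrP: irr_phi => s Ds; rewrite Ds; apply: irrInd.
rewrite constt_Ind_Res irr_consttE.
have -> : 'Res[U] 'chi_s = theta 1%g *: 'chi_t.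
  apply/cfun_inP=> u Uu; rewrite -Ds -Dt cfResE // !cfunE cfResE //.
  by congr (_ * _); rewrite -[u]mulg1 cfSdprodE.
case/irrP: irr_theta => j ->.
by rewrite cfdotZl cfnorm_irr mulr1 irr1_neq0.
Qed.

(** The Clifford correspondent of chi divided by the linear character ext is
    constant on U, hence it is inflated from the complement H. *)
Lemma little_group_exhaust chi :
    chi \in irr G -> '['Res[U] chi, 'Res[U] ext] != 0 ->
  exists2 theta, theta \in irr H & chi = 'Ind[G] (cfSdprod defT theta * ext).
Proof.
case/irrP=> i ->; have /irrP[t Dt] := lin_char_irr lin_psi.
rewrite Dt => nz_it.
have [|_ exInd ResU] := inertia_correspondence (T := T) (t := t) nsUG.
  by rewrite -Dt.
have [|s As ->] := exInd i; first by rewrite constt_Ind_Res irr_consttE.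
have [c Dc] := ResU s As.
(* A linear character has absolute value 1: its conjugate is its inverse. *)
pose phi := 'chi_s * (ext^*)%CF.
have irr_phi : phi \in irr T.
  by rewrite /phi mulrC mul_lin_irr ?cfConjC_lin_char ?mem_irr.
have kerU : U \subset cfker phi.
  have phiU u : u \in U -> phi u = c.
    move=> Uu; rewrite !cfunE -[X in X * _](cfResE _ sUT Uu) Dc -Dt.
    rewrite cfunE cfResE //.
    by rewrite -mulrA -normCK normC_lin_char ?(subsetP sUT) // expr1n mulr1.
  case/irrP: irr_phi phiU => j -> phiU.
  by apply/subsetP=> u Uu; rewrite cfkerEirr inE !phiU.
exists ('Res[H] phi); first exact: (Res_sdprod_irr defT).
congr ('Ind _); rewrite cfRes_sdprodK // /phi -mulrA [_ * ext]mulrC.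
by rewrite mul_conjC_lin_char ?mulr1.
Qed.

End LittleGroups.

(** This recognizes the theta of another representative of an L-orbit of pairs
    as irreducible. *)
Lemma irr_conj_transport (gT : finGroupType) (H K : {group gT}) r
    (theta : 'CF(H)) (phi : 'CF(K)) :
    H = (K :^ r^-1)%g :> {set gT} ->
    {in H, forall h, theta h = phi (h ^ r)%g} ->
  phi \in irr K -> theta \in irr H.
Proof.
move=> defH Dtheta irr_phi.
have isoKH : isom K H (conjgm K (r^-1)%g) by rewrite defH; apply: conj_isom.
suff -> : theta = cfIsom isoKH phi by rewrite cfIsom_irr.
apply/cfun_inP=> h Hh; rewrite Dtheta //.
have Khr : (h ^ r)%g \in K by rewrite -mem_conjgV -defH.
by rewrite -{2}[h](conjgK r) -(conjgmE K (r^-1)%g) cfIsomE.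
Qed.

(** * The parabolic subgroup when J has square zero *)

Section SquareZero.

Variables (F : finFieldType) (N : nat) (blk : 'I_N.+1 -> nat).
Hypothesis blk_le1 : forall i, (blk i <= 1)%N.

(* Products and inverses of matrices are those of the finGroupType structure:
   the ascription in mx imposes it where the expected type is that of GLval. *)
Local Notation gT := ({'GL_N.+1[F]} : finGroupType).
Local Notation mT := 'M[F]_N.+1.
Local Notation mx g := (@GLval N.+1 F (g : gT) : mT).
Local Notation J := (nilJ F blk).
Local Notation G := (parabolic F blk).
Local Notation L := (levi F blk).
Local Notation U := (unipU F blk).

Implicit Types (g h p r u v : gT) (x y z : mT).

Lemma nilJ_mul0 x y : x \in J -> y \in J -> x *m y = 0.
Proof.
move=> /nilJP Jx /nilJP Jy; apply/matrixP=> i j; rewrite !mxE big1 // => k _.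
have [leki | ltik] := leqP (blk k) (blk i); first by rewrite Jx ?mul0r.
by rewrite Jy ?mulr0 // (leq_trans (blk_le1 j)) // (leq_ltn_trans _ ltik).
Qed.

Lemma nilJZ a x : x \in J -> a *: x \in J.
Proof. by move=> Jx; rewrite -[_ *: _]addr0 nilJ_lin ?nilJ0. Qed.

Lemma nilJN x : x \in J -> - x \in J.
Proof. by move=> Jx; rewrite -scaleN1r nilJZ. Qed.

Lemma GLmx_inj (g h : gT) : mx g = mx h -> g = h.
Proof. by move=> eq_gh; apply: val_inj. Qed.

Lemma GLmxVK (g : gT) : mx g^-1%g *m mx g = 1.
Proof. by rewrite -[LHS]/(mx (g^-1 * g)%g) mulVg. Qed.

Lemma GLmxKV (g : gT) : mx g *m mx g^-1%g = 1.
Proof. by rewrite -[LHS]/(mx (g * g^-1)%g) mulgV. Qed.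

Lemma parabolicV (g : gT) : g \in G -> g^-1%g \in G.
Proof. exact: (@groupVr _ (parabolic_group F blk)). Qed.

Lemma levi_sub (g : gT) : g \in L -> g \in G.
Proof. exact: (subsetP (levi_parabolic F blk)). Qed.

Lemma nilJ_conj g x : g \in G -> x \in J -> mx g^-1%g *m x *m mx g \in J.
Proof. by move=> Gg Jx; apply/nilJ_mulr/nilJ_mull/Jx/parabolicV. Qed.

(** Singular matrices go to 1, so that the function is total. *)
Definition GLof (a : mT) : gT := insubd (1%g : gT) a.

Lemma GLofK a b : a *m b = 1 -> b *m a = 1 -> mx (GLof a) = a.
Proof. by move=> ab ba; rewrite [LHS]insubdK //; apply/unitrP; exists b. Qed.

(** The element 1 + x of the group U. *)
Definition U1 x : gT := GLof (1 + x).

(** The inverse of 1 + x is 1 - x, as x has square zero. *)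
Lemma U1K x : x \in J -> mx (U1 x) = 1 + x.
Proof.
move=> Jx; apply: (@GLofK _ (1 - x)).
  by rewrite mulmxE mulrDl mul1r mulrBr mulr1 -mulmxE nilJ_mul0 // subr0 subrK.
by rewrite mulmxE mulrBl mul1r mulrDr mulr1 -mulmxE nilJ_mul0 // addr0 addrK.
Qed.

Lemma U1_unip x : x \in J -> U1 x \in U.
Proof. by move=> Jx; rewrite mem_oneplus U1K // addrAC subrr add0r. Qed.

Lemma U1_sub1 x : x \in J -> mx (U1 x) - 1 = x.
Proof. by move=> Jx; rewrite U1K // addrAC subrr add0r. Qed.

Lemma sub1_U1 u : u \in U -> U1 (mx u - 1) = u.
Proof.
by rewrite mem_oneplus => Ju; apply: GLmx_inj; rewrite U1K // addrC subrK.
Qed.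

Lemma unip_mulE u v : u \in U -> v \in U ->
  mx (u * v)%g - 1 = (mx u - 1) + (mx v - 1).
Proof.
move=> Uu Uv; rewrite -{1}(sub1_U1 Uu) -{1}(sub1_U1 Uv) GL_ME.
move: Uu Uv; rewrite !mem_oneplus => Uu Uv; rewrite !U1K //.
move: (mx u - 1) (mx v - 1) Uu Uv => a b Ja Jb.
rewrite mulrDl mul1r mulrDr mulr1 -mulmxE nilJ_mul0 // addr0.
by rewrite -(addrA 1) (addrC 1) addrK addrC.
Qed.

Fact unipU_group_set : group_set U.
Proof.
apply/group_setP; split=> [|u v Uu Uv].
  by rewrite mem_oneplus GL_1E subrr nilJ0.
by rewrite mem_oneplus unip_mulE // nilJD // -mem_oneplus.
Qed.
Canonical unipU_group := Group unipU_group_set.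

Lemma U1D x y : x \in J -> y \in J -> (U1 x * U1 y)%g = U1 (x + y).
Proof.
move=> Jx Jy; rewrite -[LHS]sub1_U1 ?groupM ?U1_unip //.
by rewrite unip_mulE ?U1_unip // !U1_sub1.
Qed.

Lemma U1_0 : U1 0 = 1%g.
Proof. by apply: GLmx_inj; rewrite U1K ?nilJ0 // addr0. Qed.

Lemma U1V x : x \in J -> ((U1 x)^-1)%g = U1 (- x).
Proof.
move=> Jx; apply: (mulgI (U1 x)); rewrite mulgV U1D ?nilJN // subrr.
exact: (esym U1_0).
Qed.

Lemma unipU_abelian : abelian U.
Proof.
apply/centsP=> u Uu v Uv; rewrite /commute -(sub1_U1 Uu) -(sub1_U1 Uv).
by rewrite !U1D -?mem_oneplus // addrC.
Qed.

Lemma U1J g x : g \in G -> x \in J ->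
  (U1 x ^ g)%g = U1 (mx g^-1%g *m x *m mx g).
Proof.
move=> Gg Jx; apply: GLmx_inj.
rewrite -[LHS]/(mx g^-1%g *m (mx (U1 x) *m mx g)).
rewrite !U1K ?nilJ_conj //.
by rewrite mulmxDl mulmxDr mul1mx GLmxVK mulmxA.
Qed.

Lemma unipU_sub : U \subset G.
Proof.
apply/subsetP=> u Uu; rewrite -(sub1_U1 Uu).
move: Uu; rewrite mem_oneplus => Ju.
apply/parabolicP=> i j ltji; rewrite U1K // mxE (nilJP _ _ Ju) ?(ltnW ltji) //.
rewrite mxE addr0; have [eij | //] := eqVneq i j.
by rewrite eij ltnn in ltji.
Qed.

Lemma unipU_normal : U <| G.
Proof.
rewrite /normal unipU_sub; apply/subsetP=> g Gg; rewrite inE.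
apply/subsetP=> _ /imsetP[u Uu ->]; rewrite -(sub1_U1 Uu).
by move: Uu; rewrite mem_oneplus => Ju; rewrite U1J // U1_unip ?nilJ_conj.
Qed.

(** The projection onto the block diagonal part is multiplicative on block
    triangular matrices; in this way the block diagonal part of an invertible
    matrix has an inverse, the block diagonal part of the inverse. *)
Definition diag_blocks (a : mT) : mT :=
  \matrix_(i, j) (if blk i == blk j then a i j else 0).

Lemma diag_blocksM g h : g \in G -> h \in G ->
  diag_blocks (mx g) *m diag_blocks (mx h) = diag_blocks (mx (g * h)%g).
Proof.
move=> /parabolicP Gg /parabolicP Gh; apply/matrixP=> i j; rewrite !mxE.
have [eij | nij] := eqVneq (blk i) (blk j); last first.
  rewrite big1 // => k _; rewrite !mxE.
  case: eqP => [eik | _]; last by rewrite mul0r.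
  by case: eqP => [ekj|]; rewrite ?mulr0 // eik ekj eqxx in nij *.
apply: eq_bigr => k _; rewrite !mxE -eij eq_sym.
case: (ltngtP (blk k) (blk i)) => [ltki | ltik | //].
  by rewrite Gg // !mul0r.
by rewrite Gh ?mulr0 // -eij.
Qed.

Lemma diag_blocks1 : diag_blocks 1 = 1.
Proof.
apply/matrixP=> i j; rewrite !mxE.
have [-> | _] := eqVneq i j; first by rewrite eqxx.
by rewrite if_same.
Qed.

Lemma parabolic_decomp g : g \in G ->
  exists h x, [/\ h \in L, x \in J & g = (h * U1 x)%g].
Proof.
move=> Gg; have GVg := parabolicV Gg; pose h := GLof (diag_blocks (mx g)).
have Dh : mx h = diag_blocks (mx g).
  apply: (@GLofK _ (diag_blocks (mx g^-1%g))).
    by rewrite diag_blocksM // mulgV diag_blocks1.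
  by rewrite diag_blocksM // mulVg diag_blocks1.
have Lh : h \in L.
  by apply/leviP=> i j nij; rewrite Dh mxE (negPf nij).
have Gh := parabolicV (levi_sub Lh); exists h, (mx (h^-1 * g)%g - 1).
have Uu : (h^-1 * g)%g \in U.
  rewrite mem_oneplus GL_ME -(GLmxVK h) -mulmxE -mulmxBr nilJ_mull //.
  apply/nilJP=> i j leji; rewrite Dh !mxE; case: eqP => [_|/eqP nij].
    by rewrite subrr.
  by rewrite subr0 (parabolicP _ _ Gg) // ltn_neqAle eq_sym nij.
by rewrite sub1_U1 // mulKVg -mem_oneplus.
Qed.

Lemma unipU_levi_TI : U :&: L = 1%g.
Proof.
apply/eqP; rewrite eqEsubset; apply/andP; split; last first.
  by apply/subsetP=> _ /set1P->; rewrite inE !group1.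
apply/subsetP=> u /setIP[Uu /leviP Lu]; apply/set1P; apply: GLmx_inj.
rewrite GL_1E -[LHS](subrK 1); move: Uu; rewrite mem_oneplus => /nilJP Ju.
suff -> : mx u - 1 = 0 by rewrite add0r.
apply/matrixP=> i j; rewrite [RHS]mxE.
have [/Ju // | ltij] := leqP (blk j) (blk i).
rewrite !mxE Lu ?neq_ltn ?ltij //.
have [eij | _] := eqVneq i j; last by rewrite subrr.
by rewrite eij ltnn in ltij.
Qed.

Lemma parabolic_sdprod : (U ><| L)%g = G.
Proof.
have nUG := normal_norm unipU_normal; have sLG := levi_parabolic F blk.
rewrite sdprodE ?unipU_levi_TI ?(subset_trans sLG) //.
apply/eqP; rewrite eqEsubset mul_subG ?unipU_sub //=.
rewrite -(normC (subset_trans sLG nUG)).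
apply/subsetP=> g /parabolic_decomp[h [x [Lh Jx ->]]].
by rewrite mem_mulg ?U1_unip.
Qed.

(** * Forms on J and their stabilizers *)

Lemma dualJ_lin lam a x y : lam \in dualJ F blk -> x \in J -> y \in J ->
  lam (a *: x + y) = a * lam x + lam y.
Proof.
rewrite inE => /andP[_ /forallP/(_ a)].
by move=> + Jx Jy => /forall_inP/(_ x Jx)/forall_inP/(_ y Jy)/eqP.
Qed.

Lemma dualJ_out lam x : lam \in dualJ F blk -> x \notin J -> lam x = 0.
Proof. by rewrite inE => /andP[/forallP/(_ x)/implyP lam0 _] /lam0/eqP. Qed.

Lemma dualJ0 lam : lam \in dualJ F blk -> lam 0 = 0.
Proof.
move=> lamJ; have := dualJ_lin (-1) lamJ (nilJ0 F blk) (nilJ0 F blk).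
by rewrite scaler0 addr0 mulN1r addNr.
Qed.

Lemma dualJD lam x y : lam \in dualJ F blk -> x \in J -> y \in J ->
  lam (x + y) = lam x + lam y.
Proof.
by move=> lamJ Jx Jy; rewrite -[x]scale1r dualJ_lin // mul1r scale1r.
Qed.

Lemma dualJZ lam a x : lam \in dualJ F blk -> x \in J ->
  lam (a *: x) = a * lam x.
Proof.
move=> lamJ Jx; rewrite -[_ *: _]addr0 (dualJ_lin _ lamJ) ?nilJ0 //.
by rewrite (dualJ0 lamJ) addr0.
Qed.

Lemma nilJ_bimul g h x : g \in G -> h \in G ->
  (mx g *m x *m mx h \in J) = (x \in J).
Proof.
move=> Gg Gh; apply/idP/idP=> [Jgxh | Jx]; last exact/nilJ_mulr/nilJ_mull.
have -> : x = mx g^-1%g *m (mx g *m x *m mx h) *m mx h^-1%g.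
  by rewrite !mulmxA GLmxVK mul1mx -mulmxA GLmxKV mulmx1.
by apply/nilJ_mulr/nilJ_mull/Jgxh; apply: parabolicV.
Qed.

(** Square zero makes both actions of U on J trivial. *)
Lemma unip_bimul u v x : u \in U -> v \in U -> x \in J -> mx u *m x *m mx v = x.
Proof.
move=> Uu Uv Jx; rewrite -(sub1_U1 Uu) -(sub1_U1 Uv).
move: Uu Uv; rewrite !mem_oneplus => Ju Jv; rewrite !U1K //.
rewrite mulmxDl mul1mx (nilJ_mul0 Ju Jx) addr0.
by rewrite mulmxDr mulmx1 (nilJ_mul0 Jx Jv) addr0.
Qed.

Lemma UUorbitE lam : lam \in dualJ F blk -> UUorbit blk lam = [set lam].
Proof.
move=> lamJ; apply/eqP; rewrite eqEsubset sub1set mem_UUorbit andbT.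
apply/subsetP=> _ /imset2P[u v Uu Uv ->]; rewrite inE; apply/eqP/ffunP=> x.
rewrite ffunE; have [Jx | notJx] := boolP (x \in J).
  by rewrite unip_bimul.
by rewrite !(dualJ_out lamJ) // nilJ_bimul ?(subsetP unipU_sub).
Qed.

Lemma UrightE lam : lam \in dualJ F blk -> Uright blk lam = U.
Proof.
move=> lamJ; congr oneplus; apply/setP=> y; rewrite inE.
apply: andb_idr => Jy; apply/forall_inP=> x Jx.
by rewrite nilJ_mul0 // dualJ0.
Qed.

Lemma mem_HUU lam h : lam \in dualJ F blk ->
  (h \in HUU blk (UUorbit blk lam)) = (h \in L) && (Adstar h lam == lam).
Proof.
move=> lamJ; rewrite inE UUorbitE //; congr (_ && _).
by apply/forall_inP/idP=> [-> // | Dlam mu /set1P->]; rewrite ?inE.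
Qed.

(** Restates the definition with the inverse of the finGroupType structure, as
    [AdE] and [KUUE] do below. *)
Lemma AdstarE lam h x : Adstar h lam x = lam (mx h^-1%g *m x *m mx h).
Proof. by rewrite ffunE. Qed.

(** Outside J both sides vanish, so that only the values on J count. *)
Lemma HUU_fixP lam h : lam \in dualJ F blk -> h \in L ->
  reflect {in J, forall x, lam (mx h^-1%g *m x *m mx h) = lam x}
          (h \in HUU blk (UUorbit blk lam)).
Proof.
move=> lamJ Lh; rewrite mem_HUU // Lh.
apply: (iffP eqP) => [/ffunP Dlam x _ | Dlam].
  by rewrite -[RHS]Dlam AdstarE.
apply/ffunP=> x; rewrite AdstarE; have [/Dlam // | notJx] := boolP (x \in J).
have Gh := levi_sub Lh; have GVh := parabolicV Gh.
by rewrite !(dualJ_out lamJ) // nilJ_bimul.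
Qed.

(** Fixing the only element of the orbit is the same as preserving the orbit;
    this is why S-irreducible characters of H are irreducible
    ([is_irr_underE]). *)
Lemma HUU_eq_SUU lam : lam \in dualJ F blk ->
  SUU blk (UUorbit blk lam) = HUU blk (UUorbit blk lam).
Proof.
move=> lamJ; apply/setP=> h; rewrite mem_HUU // inE UUorbitE //; congr (_ && _).
rewrite /AdstarS imset_set1; apply/eqP/eqP=> [/setP/(_ lam) | -> //].
by rewrite !inE eqxx => /eqP.
Qed.

Lemma HUU_AdstarS (O : {set {ffun mT -> F}}) r : r \in L ->
  HUU blk (AdstarS r O) = (HUU blk O :^ r^-1)%g.
Proof.
move=> Lr; apply/setP=> h; rewrite mem_conjgV [LHS]inE [RHS]inE groupJr //.
congr (_ && _).
have AdK mu s : Adstar s^-1%g (Adstar s mu) = mu.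
  by rewrite -AdstarM mulVg Adstar1.
apply/forall_inP/forall_inP=> Hmu mu.
  move=> Omu; have /eqP E := Hmu _ (imset_f (Adstar r) Omu).
  by rewrite conjgE !AdstarM E AdK.
case/imsetP=> nu Onu ->; have /eqP E := Hmu nu Onu.
by rewrite -{2}E -!AdstarM -conjgC.
Qed.

(** * Characters *)

Section Characters.

Variable eps : F -> algC.
Hypothesis epsP : nontrivial_add_char eps.

Lemma eps0 : eps 0 = 1.
Proof.
have [epsD eps_neq0 _] := epsP; apply: (mulfI (eps_neq0 0)).
by rewrite -epsD addr0 mulr1.
Qed.

(** Nontriviality of eps enters here: the multiples of a nonzero element fill
    the field, so that eps cannot be 1 on all of them.  A form lam is therefore
    determined by the character eps (lam x), since lam (c x) = c lam x. *)
Lemma eps_separates a b : (forall c, eps (c * a) = eps (c * b)) -> a = b.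
Proof.
have [epsD eps_neq0 [d eps_d]] := epsP => eq_ab.
apply: contraNeq eps_d => neq_ab.
have nz : a - b != 0 by rewrite subr_eq0.
rewrite -[d](divfK nz) mulrBr.
apply/eqP/(mulIf (eps_neq0 (d / (a - b) * b))).
by rewrite -epsD subrK eq_ab mul1r.
Qed.

(** The linear character 1 + x |-> eps (lam x) of U extends to the product of U
    with the stabilizer of lam by the value 1 on the stabilizer.  This product
    is its whole inertia group: if h in L fixes the character then it fixes
    lam, by [eps_separates]. *)
Lemma linear_extension lam : lam \in dualJ F blk ->
  exists ext : 'CF(HUU blk (UUorbit blk lam) <*> Uright blk lam),
  [/\ ext \is a linear_char,
      forall h x, h \in HUU blk (UUorbit blk lam) -> x \in J ->
        ext (h * U1 x)%g = eps (lam x)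
    & 'I_G['Res[U] ext]%g = HUU blk (UUorbit blk lam) <*> Uright blk lam].
Proof.
move=> lamJ; have [ext extE] :=
  xi_exists epsP lamJ (1 : 'CF(HUU_group blk (UUorbit blk lam))).
have defV : Uright blk lam = U by apply: UrightE.
have {}extE h x : h \in HUU blk (UUorbit blk lam) -> x \in J ->
    ext (h * U1 x)%g = eps (lam x).
  move=> Hh Jx; have Vx : U1 x \in Uright blk lam by rewrite defV U1_unip.
  rewrite (extE h (U1 x) Hh Vx) -[RHS]mul1r.
  congr (_ * eps (lam _)); last exact: U1_sub1.
  by rewrite (@cfun1E _ (HUU_group blk (UUorbit blk lam))) Hh.
set H := HUU blk (UUorbit blk lam) in ext extE *.
set V := Uright blk lam in defV ext extE *.
have sHL : H \subset L by apply/subsetP=> h; rewrite mem_HUU // => /andP[].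
have sHG := subset_trans sHL (levi_parabolic F blk).
have nUG := normal_norm unipU_normal.
have nUH : H \subset 'N(U) by apply: subset_trans sHG nUG.
have defT : H <*> V = (H * U)%g.
  by rewrite defV (@norm_joinEl _ (HUU_group blk _) unipU_group).
have TP g : g \in H <*> V ->
    exists h x, [/\ h \in H, x \in J & g = (h * U1 x)%g].
  rewrite defT => /mulsgP[h u Hh Uu ->]; exists h, (mx u - 1).
  by rewrite sub1_U1 // -mem_oneplus.
pose HG := HUU_group blk (UUorbit blk lam).
have [epsD eps_neq0 _] := epsP.
have lamH h x : h \in H -> x \in J -> lam (mx h^-1%g *m x *m mx h) = lam x.
  by move=> Hh; move: x; apply/HUU_fixP => //; apply: (subsetP sHL).
have ext_lin : ext \is a linear_char.
  apply: lin_char_of_morph => [|g1 g2].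
    have -> : 1%g = (1 * U1 0)%g :> gT by rewrite mul1g U1_0.
    by rewrite extE ?nilJ0 ?(group1 HG) // dualJ0 // eps0.
  move=> /TP[h [x [Hh Jx ->]]] /TP[k [y [Hk Jy ->]]].
  have Gk := levi_sub (subsetP sHL k Hk); have Jxk := nilJ_conj Gk Jx.
  have -> : (h * U1 x * (k * U1 y) = h * k * U1 (mx k^-1%g *m x *m mx k + y))%g.
    by rewrite -U1D // -U1J // conjgE !mulgA mulgK.
  rewrite !extE ?(groupM (G := HG)) ?nilJD //.
  by rewrite dualJD // lamH // epsD.
exists ext; split=> //.
have sUT : U \subset H <*> V by rewrite defT mulG_subr.
have sTG : H <*> V \subset G by rewrite defT mul_subG // unipU_sub.
have resE x : x \in J -> 'Res[U] ext (U1 x) = eps (lam x).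
  move=> Jx; rewrite cfResE ?U1_unip // -[U1 x]mul1g extE //.
pose TG := [group of H <*> V].
apply/eqP; rewrite eqEsubset; apply/andP; split; last first.
  rewrite subsetI sTG; have nUT := subset_trans sTG nUG.
  have := sub_inertia_Res (H := TG) (K := unipU_group) (G := TG) ext nUT.
  rewrite (setIidPl (sub_inertia (H := TG) ext)) => /subset_trans-> //.
  exact: subsetIr.
apply/subsetP=> _ /setIP[/parabolic_decomp[h [x [Lh Jx ->]]] Ihx].
rewrite defT mem_mulg ?U1_unip //; apply/HUU_fixP=> // y Jy.
have Gh := levi_sub Lh; have Jyh := nilJ_conj Gh Jy.
have Ih : h \in 'I['Res[U] ext]%g.
  have Ix := subsetP (sub_inertia ('Res[U] ext)) _ (U1_unip Jx).
  by rewrite groupMr in Ihx.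
apply: eps_separates => c.
rewrite -!dualJZ // -!resE ?nilJZ //.
rewrite -(inertia_valJ (U1 (c *: y)) Ih) U1J ?nilJZ //.
by rewrite -scalemxAr -scalemxAl.
Qed.

(** The form tr (c^T x), cut off outside J; distinct c in J give distinct forms,
    which are numerous enough to exhaust the characters of U by counting. *)
Definition pairing_form (c : mT) : {ffun mT -> F} :=
  [ffun x => if x \in J then \sum_i \sum_j c i j * x i j else 0].

Lemma pairing_form_dualJ c : pairing_form c \in dualJ F blk.
Proof.
rewrite inE; apply/andP; split; apply/forallP=> a.
  by apply/implyP=> /negPf notJa; rewrite ffunE notJa.
apply/forall_inP=> x Jx; apply/forall_inP=> y Jy.
rewrite !ffunE Jx Jy nilJ_lin // mulr_sumr -big_split; apply/eqP.
apply: eq_bigr => i _; rewrite mulr_sumr -big_split; apply: eq_bigr => j _ /=.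
by rewrite !mxE mulrDr mulrCA.
Qed.

Lemma pairing_form_inj : {in J &, injective pairing_form}.
Proof.
move=> c d Jc Jd /ffunP eq_cd; apply/matrixP=> i j.
have [leji | ltij] := leqP (blk j) (blk i).
  by rewrite (nilJP _ _ Jc) // (nilJP _ _ Jd).
have Jij : delta_mx i j \in J.
  apply/nilJP=> k l lelk; rewrite mxE.
  have [/andP[/eqP Dk /eqP Dl] | //] := boolP ((k == i) && (l == j)).
  by rewrite Dk Dl leqNgt ltij in lelk.
have coord e : \sum_k \sum_l e k l * (delta_mx i j : mT) k l = e i j.
  rewrite (bigD1 i) //= [X in _ + X]big1 ?addr0 => [|k nki]; last first.
    by rewrite big1 // => l _; rewrite mxE (negPf nki) mulr0.
  rewrite (bigD1 j) //= [X in _ + X]big1 ?addr0 => [|l nlj].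
    by rewrite mxE !eqxx mulr1.
  by rewrite mxE (negPf nlj) andbF mulr0.
by have := eq_cd (delta_mx i j); rewrite !ffunE Jij !coord.
Qed.

Lemma card_unipU : #|U| = #|J|.
Proof.
have -> : U = U1 @: J.
  apply/setP=> u; apply/idP/imsetP=> [Uu | [x Jx ->]]; last exact: U1_unip.
  by exists (mx u - 1); rewrite ?sub1_U1 // -mem_oneplus.
apply: card_in_imset => x y Jx Jy /(congr1 (fun u => mx u - 1)).
by rewrite !U1_sub1.
Qed.

(** By counting: the abelian group U has #|U| = #|J| irreducible characters,
    and the elements c of J give pairwise different characters
    1 + x |-> eps (tr (c^T x)). *)
Lemma irr_unipU_form (i : Iirr unipU_group) :
  exists2 lam, lam \in dualJ F blk
             & {in J, forall x, 'chi_i (U1 x) = eps (lam x)}.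
Proof.
have ex_i c : exists j : Iirr unipU_group,
    {in J, forall x, 'chi_j (U1 x) = eps (pairing_form c x)}.
  have lamJ := pairing_form_dualJ c.
  have [ext [ext_lin extE _]] := linear_extension lamJ.
  have sUT : U \subset HUU blk (UUorbit blk (pairing_form c))
                     <*> Uright blk (pairing_form c).
    by rewrite UrightE // joing_subr.
  have /irrP[j Dj] := lin_char_irr (cfRes_lin_char unipU_group ext_lin).
  exists j => x Jx; rewrite -Dj cfResE ?U1_unip // -[U1 x]mul1g extE //.
have [f fE] := fin_all_exists ex_i.
have f_inj : {in J &, injective f}.
  move=> c d Jc Jd eq_cd; apply: pairing_form_inj => //; apply/ffunP=> x.
  have [Jx | notJx] := boolP (x \in J); last by rewrite !ffunE (negPf notJx).
  apply: eps_separates => a; rewrite -!dualJZ ?pairing_form_dualJ //.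
  by rewrite -!fE ?nilJZ // eq_cd.
have : i \in f @: J.
  suff -> : f @: J = setT by rewrite inE.
  apply/eqP; rewrite eqEcard subsetT cardsT card_in_imset //.
  by rewrite card_Iirr_abelian ?unipU_abelian ?card_unipU //; apply: leqnn.
case/imsetP=> c _ ->; exists (pairing_form c); last exact: fE.
exact: pairing_form_dualJ.
Qed.

Lemma HUU_unip_sdprod lam : lam \in dualJ F blk ->
  (U ><| HUU blk (UUorbit blk lam))%g
    = HUU blk (UUorbit blk lam) <*> Uright blk lam.
Proof. by move=> lamJ; rewrite -(Uright_sdprod lamJ) UrightE. Qed.

(** Identifies the character induced in the construction with the product that
    the little group method uses. *)
Lemma xi_cfSdprod lam (theta : 'CF(HUU_group blk (UUorbit blk lam)))
    (ext : 'CF(HUU_group blk (UUorbit blk lam) <*> Uright blk lam))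
    (lamJ : lam \in dualJ F blk) :
    (forall h x, h \in HUU blk (UUorbit blk lam) -> x \in J ->
        ext (h * U1 x)%g = eps (lam x)) ->
  is_xi eps theta (cfSdprod (HUU_unip_sdprod lamJ) theta * ext).
Proof.
move=> extE h u Hh; rewrite {1}UrightE // => Uu.
rewrite cfunE -{2}(sub1_U1 Uu) extE -?mem_oneplus //; congr (_ * _).
rewrite cfkerMr ?(subsetP (cfker_sdprod _ _)) //.
exact: cfSdprodEr.
Qed.

Lemma is_irr_underE lam (theta : 'CF(HUU blk (UUorbit blk lam))) :
    lam \in dualJ F blk ->
  is_irr_under (SUU_group blk (UUorbit blk lam)) theta
    <-> theta \in irr (HUU_group blk (UUorbit blk lam)).
Proof.
move=> lamJ; set H := HUU_group blk (UUorbit blk lam).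
have sumE (i : Iirr H) :
    \sum_(psi <- ('chi_i ^: SUU_group blk (UUorbit blk lam))%CF) psi = 'chi_i.
  rewrite cfclass_invariant ?big_seq1 //.
  by rewrite /= HUU_eq_SUU // (sub_inertia (H := H)).
split=> [[i ->] | /irrP[i ->]]; first by rewrite sumE mem_irr.
by exists i; rewrite sumE.
Qed.

Lemma ind_xi_irr lam (theta : 'CF(HUU blk (UUorbit blk lam))) xi :
    lam \in dualJ F blk -> theta \in irr (HUU_group blk (UUorbit blk lam)) ->
    is_xi eps theta xi ->
  'Ind[G] xi \in irr (parabolic_group F blk).
Proof.
move=> lamJ irr_theta xiP.
have [ext [ext_lin extE inertT]] := linear_extension lamJ.
rewrite (xi_unique lamJ xiP (xi_cfSdprod theta lamJ extE)).
exact: (little_group_irr unipU_normal _ ext_lin inertT irr_theta).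
Qed.

Lemma irr_ind_xi chi : chi \in irr (parabolic_group F blk) ->
  exists lam (theta : 'CF(HUU blk (UUorbit blk lam))) xi,
  [/\ lam \in dualJ F blk, theta \in irr (HUU_group blk (UUorbit blk lam)),
      is_xi eps theta xi & chi = 'Ind[G] xi].
Proof.
move=> irr_chi; have nz_res : 'Res[unipU_group] chi != 0.
  by case/irrP: irr_chi => i ->; rewrite Res_irr_neq0 ?unipU_sub.
have [i] := neq0_has_constt nz_res; rewrite irr_consttE => chi_i.
have [lam lamJ iE] := irr_unipU_form i.
have [ext [ext_lin extE inertT]] := linear_extension lamJ.
have sUT : U \subset HUU blk (UUorbit blk lam) <*> Uright blk lam.
  by rewrite UrightE // joing_subr.
have resE : 'Res[unipU_group] ext = 'chi_i.
  apply/cfun_inP=> u Uu; rewrite -(sub1_U1 Uu).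
  move: Uu; rewrite mem_oneplus => Ju.
  rewrite cfResE ?U1_unip // iE // -[U1 _]mul1g extE //.
have [|theta irr_theta ->] :=
  little_group_exhaust unipU_normal (HUU_unip_sdprod lamJ) ext_lin inertT
    irr_chi.
  by rewrite resE.
exists lam, theta, (cfSdprod (HUU_unip_sdprod lamJ) theta * ext); split=> //.
exact: xi_cfSdprod.
Qed.

(** The pair in the orbit alpha from which the character is induced need not
    be the one that witnesses alpha; they are conjugate under L. *)
Lemma UU_characters chi :
  (exists2 alpha, AA (blk := blk) alpha & is_chiUU eps alpha chi)
    <-> chi \in irr (parabolic F blk).
Proof.
split=> [[alpha [p [[mu muJ tag_p] irr_p] alphaE]] | irr_chi].
  case=> lam [theta [lamJ /alphaE[r [Lr /= tagE thetaE]] [xi xiP ->]]].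
  apply: (ind_xi_irr lamJ _ xiP).
  have irr_phi : tagged p \in irr (HUU_group blk (tag p)).
    case: p tag_p irr_p {alphaE tagE thetaE} => O phi /= defO.
    by move: phi; rewrite {}defO => phi /(is_irr_underE phi muJ).
  apply: (irr_conj_transport (K := HUU_group blk (tag p)) _ thetaE irr_phi).
  by rewrite /= tagE HUU_AdstarS.
have [lam [theta [xi [lamJ irr_theta xiP ->]]]] := irr_ind_xi irr_chi.
pose p : UUpair F blk := Tagged (fun O => 'CF(HUU blk O)) theta.
exists (Lconj_pair p).
  exists p => //; split; first by exists lam.
  exact/is_irr_underE.
exists lam, theta; split=> //; last by exists xi.
exists 1%g; split=> [||h _]; rewrite ?conjg1 //.
by rewrite /AdstarS (eq_imset _ (@Adstar1 F N)) imset_id.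
Qed.

End Characters.

(** * Conjugacy classes *)

Lemma AdE h x : Ad h x = mx h *m x *m mx h^-1%g.
Proof. by []. Qed.

Lemma AdM g h x : Ad (g * h)%g x = Ad g (Ad h x).
Proof. by rewrite !AdE invMg !GL_MxE !mulmxA. Qed.

Lemma Ad1 x : Ad 1%g x = x.
Proof. by rewrite AdE invg1 GL_1E mul1mx mulmx1. Qed.

Lemma Ad_lin h a x y : Ad h (a *: x + y) = a *: Ad h x + Ad h y.
Proof. by rewrite !AdE mulmxDr mulmxDl -scalemxAr -scalemxAl. Qed.

Lemma AdD h x y : Ad h (x + y) = Ad h x + Ad h y.
Proof. by rewrite -[x]scale1r Ad_lin !scale1r. Qed.

Lemma AdB h x y : Ad h (x - y) = Ad h x - Ad h y.
Proof. by rewrite addrC -scaleN1r Ad_lin scaleN1r addrC. Qed.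

Lemma nilJ_Ad h x : h \in G -> x \in J -> Ad h x \in J.
Proof.
move=> Gh Jx; rewrite AdE.
by apply/nilJ_mulr/nilJ_mull/Jx; rewrite ?parabolicV.
Qed.

(** The image of Ad_h - 1 is a subspace, and any subspace of J is an ideal
    because J * J = 0. *)
Lemma JhE h : h \in L -> Jh blk h = [set Ad h x - x | x in J].
Proof.
move=> Lh; have Gh := levi_sub Lh; have [idJh triv least] := Jh_least Lh.
apply/eqP; rewrite eqEsubset; apply/andP; split; last first.
  by apply/subsetP=> _ /imsetP[x Jx ->]; apply: (forall_inP triv).
have sJ : {subset [set Ad h x - x | x in J] <= J}.
  by move=> _ /imsetP[x Jx ->]; rewrite nilJD ?nilJN ?nilJ_Ad.
have im0 : 0 \in [set Ad h x - x | x in J].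
  by apply/imsetP; exists 0; rewrite ?nilJ0 // subr0 AdE mulmx0 mul0mx.
apply: least; last by apply/forall_inP=> x Jx; apply: imset_f.
apply/is_idealP; split=> //; first exact/subsetP.
  move=> a _ _ /imsetP[x Jx ->] /imsetP[y Jy ->].
  apply/imsetP; exists (a *: x + y); first exact: nilJ_lin.
  by rewrite Ad_lin scalerBr opprD addrACA.
by move=> x y /sJ Jx Jy; rewrite !nilJ_mul0.
Qed.

Lemma Jh_sub h : h \in L -> {subset Jh blk h <= J}.
Proof.
move=> Lh y; rewrite JhE // => /imsetP[x Jx ->].
by rewrite nilJD ?nilJN // nilJ_Ad ?levi_sub.
Qed.

Lemma addcoset_sub h x : h \in L -> x \in J ->
  {subset addcoset (Jh blk h) x <= J}.
Proof. by move=> Lh Jx _ /imsetP[y /(Jh_sub Lh) Jy ->]; rewrite nilJD. Qed.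

Lemma UUorbit_modE h x : h \in L -> x \in J ->
  UUorbit_mod blk h x = [set addcoset (Jh blk h) x].
Proof.
move=> Lh Jx; have sJ := addcoset_sub Lh Jx.
have bimulE u v : u \in U -> v \in U ->
    bimulS u (addcoset (Jh blk h) x) v = addcoset (Jh blk h) x.
  move=> Uu Uv; rewrite -[RHS]imset_id; apply: eq_in_imset => y /sJ Jy.
  exact: unip_bimul.
apply/setP=> c; rewrite inE; apply/imset2P/eqP=> [[u v Uu Uv ->] | ->].
  exact: bimulE.
by exists 1%g 1%g; rewrite ?bimulE ?(group1 unipU_group).
Qed.

Lemma preim_modE h x : h \in L -> x \in J ->
  preim_mod blk h (UUorbit_mod blk h x) = addcoset (Jh blk h) x.
Proof.
move=> Lh Jx; rewrite UUorbit_modE //.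
have [/is_idealP[_ I0 Il _] _ _] := Jh_least Lh.
apply/setP=> y; rewrite [LHS]inE in_set1; apply/andP/idP=> [[Jy /eqP <-] | xIy].
  by apply/imsetP; exists 0; rewrite ?addr0.
split; first exact: (addcoset_sub Lh Jx).
case/imsetP: xIy => z Iz ->; apply/eqP/setP=> w.
apply/imsetP/imsetP=> -[t It ->].
  by exists (z + t); rewrite ?addrA // -[z]scale1r Il.
exists (t - z); first by rewrite addrC -scaleN1r Il.
by rewrite -addrA (addrC t) addNKr.
Qed.

Lemma levi_U1_parabolic h x : h \in L -> x \in J -> (h * U1 x)%g \in G.
Proof.
move=> Lh Jx; apply: (groupM (G := parabolic_group F blk)).
  exact: levi_sub.
exact/(subsetP unipU_sub)/U1_unip.
Qed.

Lemma levi_conj r h : r \in L -> h \in L -> (r * h * r^-1)%g \in L.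
Proof.
move=> Lr Lh; apply: (groupM (G := levi_group F blk)).
  exact: (groupM (G := levi_group F blk)).
exact: (groupVr (G := levi_group F blk)).
Qed.

(** Ad_r intertwines Ad_h - 1 with Ad_{rhr^-1} - 1. *)
Lemma Lact_UUorbit_mod r h x : r \in L -> h \in L -> x \in J ->
  Lact_pair r (h, UUorbit_mod blk h x)
    = ((r * h * r^-1)%g : gT, UUorbit_mod blk ((r * h * r^-1)%g : gT) (Ad r x)).
Proof.
move=> Lr Lh Jx; have Lrh : (r * h * r^-1)%g \in L by apply: levi_conj.
have Gr := levi_sub Lr; have JAdx := nilJ_Ad Gr Jx.
rewrite /Lact_pair /= !UUorbit_modE // imset_set1; congr (_, [set _]).
have AdrJ : Jh blk (r * h * r^-1)%g = [set Ad r y | y in Jh blk h].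
  rewrite !JhE // -imset_comp; apply/setP=> y.
  apply/imsetP/imsetP=> [[z Jz ->] | [z Jz ->]].
    exists (Ad r^-1%g z); first by rewrite nilJ_Ad ?parabolicV.
    by rewrite /= AdB -!AdM mulgV Ad1 ?mulgA.
  exists (Ad r z); first exact: nilJ_Ad.
  by rewrite /= AdB -!AdM mulgKV.
rewrite /addcoset AdrJ -imset_comp /bimulS -imset_comp.
by apply: eq_imset => y /=; rewrite -AdD.
Qed.

(** The conjugating element has the parameter Ad_h y rather than y, so that its
    inverse becomes 1 - y when moved to the right of h. *)
Lemma conj_U1 h x y : h \in L -> x \in J -> y \in J ->
  ((h * U1 x) ^ U1 (Ad h y) = h * U1 (x + (Ad h y - y)))%g.
Proof.
move=> Lh Jx Jy; have Gh := levi_sub Lh; have JAd := nilJ_Ad Gh Jy.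
have moveh : (U1 (- Ad h y) * h = h * U1 (- y))%g.
  rewrite conjgC U1J ?nilJN //; congr (_ * U1 _)%g.
  rewrite AdE mulmxN mulNmx !mulmxA GLmxVK mul1mx.
  by rewrite -mulmxA GLmxVK mulmx1.
rewrite conjgE U1V // !mulgA moveh -!mulgA !U1D ?nilJD ?nilJN //.
by congr (_ * U1 _)%g; rewrite addrC addrA.
Qed.

Lemma coset_addcoset_class h x : h \in L -> x \in J ->
  (h *: oneplus (addcoset (Jh blk h) x))%g = ((h * U1 x) ^: U)%g.
Proof.
move=> Lh Jx; have Gh := levi_sub Lh.
apply/setP=> g; apply/lcosetP/imsetP=> [[u + ->] | [v Uv ->]].
  rewrite mem_oneplus => xIu; have Ju := addcoset_sub Lh Jx xIu.
  case/imsetP: xIu => z; rewrite JhE // => /imsetP[y Jy ->] Du.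
  exists (U1 (Ad h y)); first exact/U1_unip/nilJ_Ad.
  by rewrite conj_U1 // -Du sub1_U1 // mem_oneplus.
have Jw : mx v - 1 \in J by rewrite -mem_oneplus.
pose y := Ad h^-1%g (mx v - 1).
have Jy : y \in J by rewrite nilJ_Ad ?parabolicV.
have JAy := nilJ_Ad Gh Jy.
exists (U1 (x + (Ad h y - y))).
  rewrite mem_oneplus U1_sub1 ?nilJD ?nilJN //.
  by apply: imset_f; rewrite JhE //; apply: imset_f.
by rewrite -conj_U1 // /y -AdM mulgV Ad1 sub1_U1.
Qed.

Lemma KUUE b : KUU blk b
  = (\bigcup_(p : gT | p \in L)
       (b.1 *: oneplus (preim_mod blk b.1 b.2)) :^ p^-1)%g.
Proof. by []. Qed.

Lemma KUU_class h x : h \in L -> x \in J ->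
  KUU blk (h, UUorbit_mod blk h x) = ((h * U1 x) ^: G)%g.
Proof.
move=> Lh Jx; rewrite KUUE /= preim_modE // coset_addcoset_class //.
apply/setP=> g; apply/bigcupP/imsetP=> [[p Lp] | [k + ->]].
  rewrite mem_conjgV => /imsetP[v Uv Dg].
  exists (v * (p : gT)^-1)%g; last by rewrite conjgM -Dg conjgK.
  apply: (groupM (G := parabolic_group F blk)).
    exact: (subsetP unipU_sub).
  exact/parabolicV/levi_sub.
rewrite -(sdprodW parabolic_sdprod) => /mulsgP[v p Uv Lp ->].
exists p^-1%g; first by rewrite (groupVr (G := levi_group F blk)).
by rewrite mem_conjgV conjgM conjgK; apply: imset_f.
Qed.

Lemma levi_conj_U1 r h x : r \in L -> x \in J ->
  ((h * U1 x) ^ r^-1 = r * h * r^-1 * U1 (Ad r x))%g.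
Proof.
move=> Lr Jx; have GVr := parabolicV (levi_sub Lr).
by rewrite conjMg (U1J GVr Jx) invgK -AdE conjgE invgK !mulgA.
Qed.

(** The set attached to a pair depends only on the L-orbit of the pair. *)
Lemma KUU_Lact r h x : r \in L -> h \in L -> x \in J ->
  KUU blk (Lact_pair r (h, UUorbit_mod blk h x)) = ((h * U1 x) ^: G)%g.
Proof.
move=> Lr Lh Jx; have Gr := levi_sub Lr; have GVr := parabolicV Gr.
rewrite Lact_UUorbit_mod // KUU_class ?nilJ_Ad //; last exact: levi_conj.
rewrite -levi_conj_U1 //.
exact: (classGidl (G := parabolic_group F blk)).
Qed.

Lemma UU_classes :
  [set KUU blk b | beta in BB F blk, b in beta]%SET = classes G.
Proof.
apply/setP=> K; apply/imset2P/imsetP=> [[beta b] | [g Gg ->]].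
  case/imsetP=> _ /imset2P[h x Lh Jx ->] -> /imsetP[r Lr ->] ->.
  rewrite KUU_Lact //.
  by exists (h * U1 x)%g => //; apply: levi_U1_parabolic.
have [h [x [Lh Jx ->]]] := parabolic_decomp Gg.
have L1 := group1 (levi_group F blk).
exists [set Lact_pair r (h, UUorbit_mod blk h x) | r in L]
  (Lact_pair 1%g (h, UUorbit_mod blk h x)); last by rewrite KUU_Lact.
  by apply: imset_f; apply: imset2_f.
exact: imset_f.
Qed.

End SquareZero.

Theorem proposition5p3 (F : finFieldType) (n1 n2 : nat)
  (n1_gt0 : (0 < n1)%N) (n2_gt0 : (0 < n2)%N)
  (eps : F -> algC) (eps_char : nontrivial_add_char eps) :
  let blk := two_segments n1 n2 in
  (forall chi : 'CF(parabolic F blk),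
     (exists2 alpha, AA alpha & is_chiUU eps alpha chi)
     <-> chi \in irr (parabolic F blk))
  /\ [set KUU blk b | beta in BB F blk, b in beta]%SET
     = classes (parabolic F blk).
Proof.
move=> blk; have blk_le1 i : (blk i <= 1)%N by apply: leq_b1.
split=> [chi|]; first exact: UU_characters.
exact: UU_classes.
Qed.
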